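(* Let $\Phi\in\mathbb{C}^{M\times N}$, with $M\le N$, be a random matrix with a continuous probability distribution, and let $B\ge 1$ be an integer. Then $\bar\Phi=I_B\otimes\Phi$ defines a universal covariance sampler with probability $1$ if and only if $$M\ge\sqrt{\frac{2NB-1}{2B-1}}.$$
   Context: A probability distribution on $\mathbb{C}^{M\times N}$ is called continuous if it is absolutely continuous with respect to Lebesgue measure, i.e. it assigns zero probability to every Borel set of $\mathbb{C}^{M\times N}$ of zero Lebesgue measure. $\otimes$ is the Kronecker product. Covariance samplers: given a linearly independent set (over $\mathbb{R}$) $\mathcal{S}$ of $L\times L$ Hermitian Toeplitz matrices, a matrix $\bar\Phi\in\mathbb{C}^{K\times L}$ defines an $\mathcal{S}$-covariance sampler if the map $\phi:\mathrm{span}_{\mathbb{R}}\,\mathcal{S}\to\mathrm{span}_{\mathbb{R}}\{\bar\Phi\Sigma_s\bar\Phi^H:\Sigma_s\in\mathcal{S}\}$, $\phi(\Sigma)=\bar\Phi\Sigma\bar\Phi^H$, is invertible. The matrix $\bar\Phi$ defines a universal covariance sampler if it defines an $\mathcal{S}$-covariance sampler for every linearly independent set $\mathcal{S}$ of $L\times L$ Hermitian Toeplitz matrices. Here $L=NB$ and $K=MB$. *)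

(* Defs.v *)
From HB Require Import structures.
From mathcomp Require Import all_boot all_order all_algebra.
From mathcomp Require Import complex mxtens.
From mathcomp Require Import all_classical all_reals all_analysis.

Set Implicit Arguments.
Unset Strict Implicit.
Unset Printing Implicit Defensive.

Import Order.TTheory GRing.Theory Num.Theory.
Local Open Scope classical_set_scope.
Local Open Scope sesquilinear_scope.
Local Open Scope complex_scope.
Local Open Scope ring_scope.

Section lebesgue_cons.
Context {R : realType} (n : nat).

Definition tuple_cons (p : measurableTypeR R * n.-tuple (measurableTypeR R)) :
  n.+1.-tuple (measurableTypeR R) := [tuple of p.1 :: p.2].

Lemma measurable_tuple_cons : measurable_fun setT tuple_cons.
Proof. by apply: measurable_cons. Qed.

Variable mu : {sigma_finite_measure set (n.-tuple (measurableTypeR R)) -> \bar R}.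

Definition lebesgue_cons : set (n.+1.-tuple (measurableTypeR R)) -> \bar R :=
  pushforward (lebesgue_measure \x mu)%E tuple_cons.

(* The library has no usable canonical instance of this fact: on products the
   instance for subprobabilities takes precedence. *)
Let lebesgue_product_sigma_finite :
  sigma_finite setT (@lebesgue_measure R \x mu)%E.
Proof.
have /sigma_finiteP[F [TF ndF Foo]] := sigma_finiteT (@lebesgue_measure R).
have /sigma_finiteP[G [TG ndG Goo]] := sigma_finiteT mu.
exists (fun k => F k `*` G k).
  rewrite -setXTT TF TG predeqE => -[x y]; split.
    move=> [/= [k _ Fkx] [l _ Gly]]; exists (maxn k l) => //; split.
    - by move: x Fkx; exact/subsetPset/ndF/leq_maxl.
    - by move: y Gly; exact/subsetPset/ndG/leq_maxr.
  by move=> [k _ []/= ? ?]; split; exists k.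
move=> k; have [? ?] := Foo k; have [? ?] := Goo k.
split; first exact: measurableX.
by rewrite product_measure1E// lte_mul_pinfty// ge0_fin_numE.
Qed.

Let lebesgue_cons0 : lebesgue_cons set0 = 0%E.
Proof. by rewrite /lebesgue_cons /pushforward preimage_set0 measure0. Qed.

Let lebesgue_cons_ge0 A : (0 <= lebesgue_cons A)%E.
Proof. exact: (measure_ge0 (lebesgue_measure \x mu)%E). Qed.

Let lebesgue_cons_sigma_additive : semi_sigma_additive lebesgue_cons.
Proof.
move=> F mF tF mUF; rewrite /lebesgue_cons /pushforward preimage_bigcup.
have mcons A : measurable A -> measurable (tuple_cons @^-1` A).
  by move=> mA; rewrite -[X in measurable X]setTI; exact: measurable_tuple_cons.
apply: measure_semi_sigma_additive.
- by move=> k; exact: mcons.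
- apply/trivIsetP => i j _ _ ij; rewrite -preimage_setI.
  by move/trivIsetP : tF => /(_ _ _ _ _ ij) ->//; rewrite preimage_set0.
- by rewrite -preimage_bigcup; exact: mcons.
Qed.

HB.instance Definition _ := isMeasure.Build _ _ _ lebesgue_cons
  lebesgue_cons0 lebesgue_cons_ge0 lebesgue_cons_sigma_additive.

Let lebesgue_cons_sigma_finite : sigma_finite setT lebesgue_cons.
Proof.
have [F TF mF] := lebesgue_product_sigma_finite.
pose g (t : n.+1.-tuple (measurableTypeR R)) :
  measurableTypeR R * n.-tuple (measurableTypeR R) := (thead t, [tuple of behead t]).
have mg : measurable_fun setT g.
  apply: measurable_fun_pair; first exact: measurable_tnth.
  exact: measurable_behead.
have gK : cancel tuple_cons g.
  by case=> x t; rewrite /g /tuple_cons theadE; congr pair; exact/val_inj.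
exists (fun k => g @^-1` F k).
  by rewrite -preimage_bigcup -TF preimage_setT.
move=> k; have [mFk Fk] := mF k; split.
  by rewrite -[X in measurable X]setTI; exact: mg.
by rewrite /lebesgue_cons /pushforward -comp_preimage (_ : g \o _ = id) //; apply/funext.
Qed.

HB.instance Definition _ := Measure_isSigmaFinite.Build _ _ _ lebesgue_cons
  lebesgue_cons_sigma_finite.

End lebesgue_cons.

(* Lebesgue measure on R^n: iterated product of the one-dimensional Lebesgue
   measure (for n = 0, the unit mass at the empty tuple). *)
Fixpoint lebesgue_tuple (R : realType) (n : nat) :
    {sigma_finite_measure set (n.-tuple (measurableTypeR R)) -> \bar R} :=
  match n with
  | 0 => @dirac _ (0.-tuple (measurableTypeR R)) [tuple] R
  | n'.+1 => lebesgue_cons (lebesgue_tuple R n')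
  end.

Lemma lebesgue_tuple_box (R : realType) (n : nat)
    (A : 'I_n -> set (measurableTypeR R)) : (forall i, measurable (A i)) ->
  lebesgue_tuple R n [set t | forall i, A i (tnth t i)] =
  (\prod_(i < n) lebesgue_measure (A i))%E.
Proof.
elim: n A => [|n IHn] A mA.
  rewrite big_ord0 /= diracE; case: (boolP (_ \in _)) => // /negP[].
  by rewrite inE => -[].
rewrite big_ord_recl -IHn // /= /lebesgue_cons /pushforward.
rewrite -product_measure1E //; last first.
  rewrite (_ : mkset _ = \bigcap_(i in [set: 'I_n]) ((@tnth n _ ^~ i) @^-1` A (lift ord0 i))).
    apply: fin_bigcap_measurable => // i _.
    by rewrite -[X in measurable X]setTI; exact: measurable_tnth.
  by apply/seteqP; split => [t h i _|t h i]; [exact: h|exact: (h i)].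
congr product_measure1; apply/seteqP; split=> -[x t] /=.
  move=> h; split; first exact: (h ord0).
  by move=> i; have := h (lift ord0 i); rewrite tnthS.
move=> [hx ht] i; case: (unliftP ord0 i) => [j|] ->; last exact: hx.
by rewrite tnthS; exact: ht.
Qed.

(* The 2mn real coordinates of a complex matrix (real parts of the entries,
   then imaginary parts); through them C^(m x n) is identified with R^(2mn),
   together with its Borel sets and its Lebesgue measure. *)
Definition mx_coords (R : realType) (m n : nat) (A : 'M[R[i]]_(m, n)) :
    (m * n + m * n).-tuple (measurableTypeR R) :=
  [tuple of [tuple complex.Re (mxvec A 0 k) | k < m * n] ++
            [tuple complex.Im (mxvec A 0 k) | k < m * n]].

Definition random_mx (R : realType) (d : measure_display)
    (T : measurableType d) (m n : nat) (X : T -> 'M[R[i]]_(m, n)) :=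
  measurable_fun [set: T] (@mx_coords R m n \o X).

(* Stated for the distribution of the real coordinate vector of X: every Borel
   set of zero Lebesgue measure has probability zero. *)
Definition continuous_distribution (R : realType) (d : measure_display)
    (T : measurableType d) (P : probability T R) (m n : nat)
    (X : T -> 'M[R[i]]_(m, n)) :=
  content_dominates (lebesgue_tuple R (m * n + m * n))
    (pushforward P (@mx_coords R m n \o X)).

(* i + j' = i' + j is i - j = i' - j' without truncated subtraction. *)
Definition toeplitz (C : Type) (n : nat) (A : 'M[C]_n) :=
  forall i j i' j' : 'I_n, (i + j' = i' + j)%N -> A i j = A i' j'.

Section real_linear.
Context {R : realType} {m n : nat}.
Implicit Type S : set 'M[R[i]]_(m, n).

(* Span and linear independence are over R, for an arbitrary set of complex
   matrices. *)
Definition real_span S : set 'M[R[i]]_(m, n) :=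
  [set A | exists k (c : 'I_k -> R) (V : 'I_k -> 'M[R[i]]_(m, n)),
     (forall l, S (V l)) /\ A = \sum_l (c l)%:C *: V l].

Definition real_free S :=
  forall k (c : 'I_k -> R) (V : 'I_k -> 'M[R[i]]_(m, n)),
    injective V -> (forall l, S (V l)) -> \sum_l (c l)%:C *: V l = 0 ->
    forall l, c l = 0.

End real_linear.

Section covariance_samplers.
Context {R : realType} {K L : nat}.
Implicit Type F : 'M[R[i]]_(K, L).

Definition compression F (A : 'M[R[i]]_L) : 'M[R[i]]_K := F *m A *m F ^t*.

Definition covariance_sampler (S : set 'M[R[i]]_L) F :=
  set_bij (real_span S) (real_span (compression F @` S)) (compression F).

Definition universal_covariance_sampler F :=
  forall S : set 'M[R[i]]_L,
    (forall A, S A -> A \is hermsymmx /\ toeplitz A) -> real_free S ->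
    covariance_sampler S F.

End covariance_samplers.

(* Main.v *)
(** Cutting a Toeplitz matrix A with diagonals t into N x N blocks turns the
    equation (I (x) Phi) A (I (x) Phi)^* = 0 into the system
      sum_(i,j) Phi_(p,i) conj(Phi_(q,N-1-j)) t_(kN+i+j) = 0
    for k < n := 2B-1 and p, q < M, that is n M^2 equations in the T := 2NB-1
    unknowns t.  Counting the real parameters of Hermitian Toeplitz matrices
    gives necessity.  Conversely a T x T minor of the system is a polynomial in
    the real and imaginary parts of Phi; unless it vanishes identically, its
    real zeros form a Lebesgue null set.  At complex values of these real
    coordinates Phi and its conjugate become two independent matrices, so one
    pair of real matrices (A, B) with a nonzero minor suffices.

    Such a pair is found by tropical means: the entries are powers of a small
    number, and row p of A, read as a polynomial in z, is dominated by its
    monomial of degree X p th when z has the th-th order of magnitude (likewise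
    Y for B).  Row (k, p, q) of the system is then dominated by the column
    k N + X p th + Y q th.  If for every d there is a magnitude at which this
    position is <= d for the rows 0..d of the minor and > d for the others, then
    some rescaling of the columns makes the minor diagonally dominant.
    Staircase functions X and Y meet these constraints exactly when
    T <= n M^2. *)

From HB Require Import structures.
Require Import Defs.
From mathcomp Require Import all_boot all_order all_algebra.
From mathcomp Require Import complex mxtens zify ring lra.
From mathcomp Require Import all_classical all_reals all_analysis.
From mathcomp Require Import measurable_realfun.

Set Implicit Arguments.
Unset Strict Implicit.
Unset Printing Implicit Defensive.

Import Order.TTheory GRing.Theory Num.Theory.
Local Open Scope classical_set_scope.
Local Open Scope sesquilinear_scope.
Local Open Scope complex_scope.
Local Open Scope ring_scope.

(** * Nonsingularity from dominating monomials *)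

(** Weighted strict diagonal dominance: for a kernel vector [v], the row at which |v_i| / w_i is
    largest has a diagonal term too big to be cancelled. *)
Lemma dominant_det_neq0 (F : realFieldType) (n : nat) (A : 'M[F]_n)
    (w : 'I_n -> F) :
  (forall i, 0 < w i) ->
  (forall i, \sum_(j | j != i) `|A i j| * w j < `|A i i| * w i) ->
  \det A != 0.
Proof.
move=> w0 domA; rewrite -det_tr; apply/negP => /det0P[v vN0 vA].
have [i0 vi0] : exists i, v 0 i != 0 by apply/rV0Pn.
pose u i := `|v 0 i| / w i.
have [i _ maxi] := arg_maxP u (erefl (i0 \in predT)).
have ui : 0 < u i.
  by apply: lt_le_trans (maxi i0 _) => //; rewrite divr_gt0 // normr_gt0.
have vE j : `|v 0 j| <= u i * w j by rewrite -ler_pdivrMr //; exact: maxi.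
have Avi : A i i * v 0 i = - \sum_(j | j != i) A i j * v 0 j.
  apply/eqP; rewrite -addr_eq0; apply/eqP.
  have := congr1 (fun B : 'rV_n => B 0 i) vA; rewrite !mxE (bigD1 i) //= => vAi.
  apply: etrans vAi; rewrite mxE mulrC; congr (_ + _).
  by apply: eq_bigr => j _; rewrite mxE mulrC.
have := domA i; rewrite -(ltr_pM2r ui) mulr_suml ltNge => /negP; apply.
have -> : `|A i i| * w i * u i = `|\sum_(j | j != i) A i j * v 0 j|.
  by rewrite -[RHS]normrN -Avi normrM -mulrA (mulrC (w i)) divfK // gt_eqF.
apply: le_trans (ler_norm_sum _ _ _) _; apply: ler_sum => j _.
by rewrite normrM -mulrA ler_wpM2l // mulrC.
Qed.

(** Row [d] lists the first T coefficients of z^(kN) a_p(z) b_q(z), where a_p and b_q are the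
    polynomials with coefficients in row p of [A] and row q of [B]. *)
Definition window_mx (F : pzRingType) (M N T : nat) (k : 'I_T -> nat)
    (p q : 'I_T -> 'I_M) (A B : 'M[F]_(M, N)) : 'M[F]_T :=
  \matrix_(d, d') \sum_(ij : 'I_N * 'I_N | (k d * N + ij.1 + ij.2 == d')%N)
    A (p d) ij.1 * B (q d) ij.2.

(* Convex in x, with slope - #{th < Th | x < X th}: against the linear weight of
   slope Th - th - 1/2 it is minimal at x = X th only. *)
Definition excess (Th : nat) (X : nat -> nat) (x : nat) : nat :=
  (\sum_(th < Th) (X th - x))%N.

Section excess.
Local Open Scope nat_scope.
Variables (Th : nat) (X : nat -> nat).
Hypothesis Xmono : {homo X : a b / a <= b}.

Lemma excessS x : excess Th X x = \sum_(th < Th) (x < X th) + excess Th X x.+1.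
Proof. by rewrite /excess -big_split /=; apply: eq_bigr => th _; lia. Qed.

Lemma sum_leq_ord (n t : nat) : \sum_(th < n) (t <= th) = n - t.
Proof.
by elim: n => [|n IH]; rewrite ?big_ord0 // big_ord_recr /= IH; lia.
Qed.

Lemma excess_lt x t : t < Th -> x < X t ->
  excess Th X x.+1 + (Th - t) <= excess Th X x.
Proof.
move=> tTh xX; rewrite [leqRHS]excessS addnC leq_add2r -sum_leq_ord.
apply: leq_sum => th _; case: (leqP t th) => // /Xmono tth.
by rewrite (leq_trans xX tth).
Qed.

Lemma excess_ge x t : t < Th -> X t <= x ->
  excess Th X x <= excess Th X x.+1 + (Th - t.+1).
Proof.
move=> tTh xX; rewrite excessS addnC leq_add2l -sum_leq_ord.
apply: leq_sum => th _; case: (ltnP t th) => [|/Xmono tth]; first by case: (x < _).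
by rewrite ltnNge (leq_trans tth xX).
Qed.

End excess.

(** * Tropical criterion for a nonzero minor *)

Section certificate.
Variables (F : realFieldType) (M N T Th : nat).
Variables (k : 'I_T -> nat) (p q : 'I_T -> 'I_M).
Variables (X Y : 'I_M -> nat -> nat) (tau : nat -> nat).
Hypothesis N_gt0 : (0 < N)%N.
Hypothesis kT : forall d, ((k d).+2 * N <= T.+1)%N.
Hypothesis X_lt : forall p th, (X p th < N)%N.
Hypothesis Y_lt : forall p th, (Y p th < N)%N.
Hypothesis X_mono : forall p, {homo X p : a b / (a <= b)%N}.
Hypothesis Y_mono : forall p, {homo Y p : a b / (a <= b)%N}.
Hypothesis tau_lt : forall d, (d.+1 < T)%N -> (tau d < Th)%N.
Hypothesis pos_le : forall (d : nat) (d' : 'I_T), (d.+1 < T)%N -> (d' <= d)%N ->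
  (k d' * N + X (p d') (tau d) + Y (q d') (tau d) <= d)%N.
Hypothesis pos_gt : forall (d : nat) (d' : 'I_T), (d.+1 < T)%N -> (d < d')%N ->
  (d < k d' * N + X (p d') (tau d) + Y (q d') (tau d))%N.

(** Column [s] is rescaled by this power of the small number. As [val] counts excesses twice, the
    odd increment lies strictly between the slopes 2(Th - tau s - 1) and 2(Th - tau s) of
    [excess_ge] and [excess_lt]. *)
Let v (s : nat) : nat := (\sum_(t < s) (2 * (Th - tau t)).-1)%N.

Let val (d : 'I_T) (x y : nat) : nat :=
  (2 * excess Th (X (p d)) x + 2 * excess Th (Y (q d)) y
    + v (k d * N + x + y))%N.

Let vS s : v s.+1 = (v s + (2 * (Th - tau s)).-1)%N.
Proof. by rewrite /v big_ord_recr. Qed.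

(* One step towards column d, in either X or Y, decreases val by at least 1. *)
Let walk_up (d : 'I_T) m x y : (x < N)%N -> (y < N)%N ->
  (k d * N + x + y + m = d)%N ->
  exists x' y', [/\ (x' < N)%N, (y' < N)%N, (k d * N + x' + y' = d)%N &
    (val d x' y' + m <= val d x y)%N].
Proof.
elim: m x y => [|m IH] x y xN yN E; first by exists x, y; split=> //; lia.
have dT := ltn_ord d; set s := (k d * N + x + y)%N in E.
have sT : (s.+1 < T)%N by lia.
(* As s < d, [pos_gt] puts the dominant term of row [d] beyond column s at magnitude [tau s]: x or y
   is still too small. *)
have := tau_lt sT => tTh; have /(_ d) := pos_gt sT; rewrite {1}/s => H.
have {H} : (s < k d * N + X (p d) (tau s) + Y (q d) (tau s))%N by apply: H; lia.
case: (ltnP x (X (p d) (tau s))) => [xX _|Xx H].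
  have xN' : (x.+1 < N)%N by have := X_lt (p d) (tau s); lia.
  have [|x' [y' [? ? ? le]]] := IH x.+1 y xN' yN; first by lia.
  exists x', y'; split=> //; have := excess_lt (@X_mono (p d)) tTh xX.
  move: le; rewrite /val -/s (_ : (k d * N + x.+1 + y = s.+1)%N); last by lia.
  by rewrite vS; lia.
have yY : (y < Y (q d) (tau s))%N by lia.
have yN' : (y.+1 < N)%N by have := Y_lt (q d) (tau s); lia.
have [|x' [y' [? ? ? le]]] := IH x y.+1 xN yN'; first by lia.
exists x', y'; split=> //; have := excess_lt (@Y_mono (q d)) tTh yY.
move: le; rewrite /val -/s (_ : (k d * N + x + y.+1 = s.+1)%N); last by lia.
by rewrite vS; lia.
Qed.

Let walk_down (d : 'I_T) m x y : (x < N)%N -> (y < N)%N ->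
  (k d * N + x + y = d + m)%N ->
  exists x' y', [/\ (x' < N)%N, (y' < N)%N, (k d * N + x' + y' = d)%N &
    (val d x' y' + m <= val d x y)%N].
Proof.
elim: m x y => [|m IH] x y xN yN E; first by exists x, y; split=> //; lia.
set s := (d + m)%N; have Es : (k d * N + x + y = s.+1)%N by rewrite /s; lia.
(* [kT] keeps every column kN + x + y below T. *)
have sT : (s.+1 < T)%N by have := kT d; lia.
have := tau_lt sT => tTh; have /(_ d (leq_addr _ _)) H := pos_le sT.
case: (ltnP (X (p d) (tau s)) x) => [|Xx].
  case: x => // x in xN E Es *; rewrite ltnS => xX.
  have [||x' [y' [? ? ? le]]] := IH x y _ yN; [by lia|by lia|].
  exists x', y'; split=> //; have := excess_ge (@X_mono (p d)) tTh xX.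
  move: le; rewrite /val Es (_ : (k d * N + x + y = s)%N); last by lia.
  by rewrite vS; lia.
case: y => [|y] in yN E Es *; first by lia.
have yY : (Y (q d) (tau s) <= y)%N by lia.
have [||x' [y' [? ? ? le]]] := IH x y xN; [by lia|by lia|].
exists x', y'; split=> //; have := excess_ge (@Y_mono (q d)) tTh yY.
move: le; rewrite /val Es (_ : (k d * N + x + y = s)%N); last by lia.
by rewrite vS; lia.
Qed.

Let walk (d : 'I_T) (ij : 'I_N * 'I_N) :
  exists2 ij' : 'I_N * 'I_N, (k d * N + ij'.1 + ij'.2 == d)%N &
    (val d ij'.1 ij'.2 + (k d * N + ij.1 + ij.2 != d)%N <= val d ij.1 ij.2)%N.
Proof.
case: ij => i j /=.
have [x [y [xN yN /eqP xy le]]] :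
    exists x y, [/\ (x < N)%N, (y < N)%N, (k d * N + x + y = d)%N &
      (val d x y + (k d * N + i + j != d)%N <= val d i j)%N].
  case: (ltngtP (k d * N + i + j)%N d) => [lt|gt|eq].
  - have [x [y [? ? ? le]]] :=
      walk_up (ltn_ord i) (ltn_ord j) (subnKC (ltnW lt)).
    by exists x, y; split=> //; lia.
  - have [x [y [? ? ? le]]] :=
      walk_down (ltn_ord i) (ltn_ord j) (esym (subnKC (ltnW gt))).
    by exists x, y; split=> //; lia.
  - by exists i, j; split=> //; lia.
by exists (Ordinal xN, Ordinal yN).
Qed.

Lemma tropical_window_det_neq0 : exists A B : 'M[F]_(M, N),
  \det (window_mx k p q A B) != 0.
Proof.
(* At most T N^2 terms lie off the diagonal, each at most [e] times the largest diagonal one; all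
   terms are positive, so none cancel. *)
pose e : F := (T * N ^ 2).+1%:R^-1.
have e_gt0 : 0 < e by rewrite invr_gt0 ltr0Sn.
have e_le1 : e <= 1 by rewrite invf_le1 ?ltr0Sn // ler1n.
pose A : 'M[F]_(M, N) := \matrix_(a, x) e ^+ (2 * excess Th (X a) x).
pose B : 'M[F]_(M, N) := \matrix_(a, y) e ^+ (2 * excess Th (Y a) y).
exists A, B.
have entry (d d' : 'I_T) : window_mx k p q A B d d' * e ^+ v d' =
    \sum_(ij : 'I_N * 'I_N | (k d * N + ij.1 + ij.2 == d')%N) e ^+ val d ij.1 ij.2.
  rewrite mxE mulr_suml; apply: eq_bigr => ij /eqP ijd.
  by rewrite !mxE -!exprD /val ijd.
apply: (@dominant_det_neq0 _ _ _ (fun d => e ^+ v d)) => d; first exact: exprn_gt0.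
have entry_norm d' : `|window_mx k p q A B d d'| * e ^+ v d' =
    \sum_(ij : 'I_N * 'I_N | (k d * N + ij.1 + ij.2 == d')%N) e ^+ val d ij.1 ij.2.
  rewrite -entry ger0_norm // mxE sumr_ge0 // => ij _.
  by rewrite !mxE -exprD exprn_ge0 // ltW.
rewrite entry_norm (eq_bigr _ (fun d' _ => entry_norm d')).
have i0 : 'I_N := Ordinal N_gt0.
have [ij0 ij0d _] := walk d (i0, i0).
have [ij ijd min_ij] := @arg_minnP _ ij0
  (fun ij : 'I_N * 'I_N => k d * N + ij.1 + ij.2 == d)%N
  (fun ij => val d ij.1 ij.2) ij0d.
set mu := val d ij.1 ij.2 in min_ij.
apply: (@lt_le_trans _ _ (e ^+ mu)); last first.
  rewrite (bigD1 ij) //= lerDl sumr_ge0 // => ij' _.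
  by rewrite exprn_ge0 // ltW.
apply: (@le_lt_trans _ _ (\sum_(d' < T) e ^+ mu.+1 *+ N ^ 2)).
  rewrite [leRHS](bigID (fun d' => d' != d)) /= -[leLHS]addr0 lerD //; last first.
    by rewrite sumr_ge0 // => d' _; rewrite mulrn_wge0 // exprn_ge0 // ltW.
  apply: ler_sum => d' d'd.
  apply: (@le_trans _ _ (\sum_(ij' : 'I_N * 'I_N) e ^+ mu.+1)); last first.
    by rewrite sumr_const card_prod card_ord expnS expn1.
  rewrite [leRHS](bigID (fun ij' : 'I_N * 'I_N =>
    k d * N + ij'.1 + ij'.2 == d')%N) /=.
  rewrite -[leLHS]addr0 lerD //; last first.
    by rewrite sumr_ge0 // => ij' _; rewrite exprn_ge0 // ltW.
  apply: ler_sum => ij' /eqP ij'd'; apply: ler_wiXn2l => //; first exact: ltW.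
  have [ij2 ij2d le2] := walk d ij'; apply: leq_trans le2.
  have := min_ij _ ij2d; rewrite ij'd' (_ : (nat_of_ord d' != d) = true) //.
  by rewrite addn1.
rewrite sumr_const card_ord -mulrnA -mulr_natr exprSr -mulrA.
rewrite gtr_pMr ?exprn_gt0 // /e mulrC ltr_pdivrMr ?ltr0Sn // mul1r ltr_nat.
by rewrite mulnC.
Qed.

End certificate.

(** * Row selections and staircases *)

Section rows.
Local Open Scope nat_scope.
Variables (M N n e : nat).
Hypotheses (M_gt0 : 0 < M) (n_gt0 : 0 < n).
Hypotheses (e_lt : e < N) (le_ne : N <= (n * e).+1).

(* The minor is split into blocks of rows: those with window index k start at
   row k N + offset k and number at most N + e.  The offset increases from 0 to
   N - 1 - e, so that the last block ends at the last column. *)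
Definition offset (k : nat) : nat := minn (k * e) (N - e.+1).

Definition block_start (k : nat) : nat := k * N + offset k.

Definition row_block (d : nat) : nat := \max_(k < n | block_start k <= d) k.

Lemma row_block_mono : {homo row_block : d d' / d <= d'}.
Proof.
move=> d d' dd'; apply/bigmax_leqP => k kd.
apply: (@leq_bigmax_cond _ (fun k : 'I_n => block_start k <= d')).
exact: leq_trans dd'.
Qed.

Lemma row_block_lt d : row_block d < n.
Proof.
rewrite -(prednK n_gt0) ltnS; apply/bigmax_leqP => k _.
by have := ltn_ord k; lia.
Qed.

Lemma row_block_ge d : block_start (row_block d) <= d.
Proof.
have [|k kd E] := @eq_bigmax_cond _ (fun k : 'I_n => block_start k <= d) (fun k => k).
  apply/card_gt0P; exists (Ordinal n_gt0).
  by rewrite unfold_in /block_start /offset /= !mul0n min0n.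
by rewrite /row_block E.
Qed.

Lemma row_block_end d : d.+1 < n.+1 * N -> d < block_start (row_block d) + (N + e).
Proof.
move=> dT; have kn := row_block_lt d; set k := row_block d in kn *.
have [k1n|nk1] := ltnP k.+1 n.
  have : ~~ (block_start k.+1 <= d).
    apply/negP => kd.
    by have := @leq_bigmax_cond _ (fun k : 'I_n => block_start k <= d) (fun k => k)
      (Ordinal k1n) kd; rewrite -/(row_block d) -/k /= ltnn.
  by rewrite -ltnNge /block_start /offset !mulSn; lia.
(* In the last block [le_ne] makes the offset N - 1 - e, so the block ends with the last row. *)
have nE : n = k.+1 by apply/eqP; rewrite eqn_leq nk1.
by move: dT le_ne; rewrite nE /block_start /offset !mulSn; lia.
Qed.

(** Inside a block the rows run through the pairs (p, q) in lexicographic order. *)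
Definition row_p (d : nat) : nat := (d - block_start (row_block d)) %/ M.
Definition row_q (d : nat) : nat := (d - block_start (row_block d)) %% M.

Lemma row_eq d :
  d = row_block d * N + (offset (row_block d) + (row_p d * M + row_q d)).
Proof.
by have := row_block_ge d; rewrite /row_p /row_q -divn_eq /block_start; lia.
Qed.

Lemma row_q_lt d : row_q d < M.
Proof. exact: ltn_pmod. Qed.

Lemma row_pq_lt d : d.+1 < n.+1 * N -> row_p d * M + row_q d < N + e.
Proof.
move=> /row_block_end; have := row_block_ge d.
by rewrite /row_p /row_q -divn_eq; lia.
Qed.

Lemma offset_le d : offset d <= N - e.+1.
Proof. exact: geq_minr. Qed.

Lemma row_p_lt d : d.+1 < n.+1 * N -> N + e <= M ^ 2 -> row_p d < M.
Proof. by move=> /row_pq_lt; nia. Qed.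

Lemma row_lex_le d d' : d' <= d ->
  [\/ row_block d' < row_block d,
      row_block d' = row_block d /\ row_p d' < row_p d |
      [/\ row_block d' = row_block d, row_p d' = row_p d & row_q d' <= row_q d]].
Proof.
move=> le; have := row_block_mono le; rewrite leq_eqVlt.
move=> /predU1P[bE|]; last by constructor 1.
have := row_eq d; have := row_eq d'; rewrite bE => E' E.
have := row_q_lt d; have := row_q_lt d'.
case: (ltngtP (row_p d') (row_p d)) => pp qM' qM.
- by constructor 2.
- suff : row_p d * M + M <= row_p d' * M by lia.
  by nia.
- by constructor 3; rewrite pp in E' *; split=> //; lia.
Qed.

Lemma row_lex_gt d d' : d < d' ->
  [\/ row_block d < row_block d',
      row_block d' = row_block d /\ row_p d < row_p d' |
      [/\ row_block d' = row_block d, row_p d' = row_p d & row_q d < row_q d']].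
Proof.
move=> lt; have [?|[-> ?]|[E1 E2 le]] := row_lex_le (ltnW lt).
- by constructor 1.
- by constructor 2.
- have := row_eq d; have := row_eq d'; rewrite E1 E2 => E' E.
  by constructor 3; split=> //; lia.
Qed.

(** * Staircases when M <= e + 1 *)

Section wide.
Hypotheses (MN : M <= N) (Me : M <= e.+1).

(* Here A is monomial (X does not depend on th), and as th grows the Y q take
   turns, from the largest q down, in increasing by one. *)
Let a1 := (N + e).-1 %/ M.
(** On 0..a1, the largest choice that is strictly increasing, below N and at most pM, the least
    value of d - kN on rows of index p when the offset is 0. *)
Let X p := minn (p * M) (minn (N - a1.+1 + p) N.-1).
Let Y q th := minn N.-1 ((th + q) %/ M).
Local Notation kd := row_block.
Local Notation pd := row_p.
Local Notation qd := row_q.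
Let y d := d - kd d * N - X (pd d).

(** At this magnitude row [d] sits exactly at column d, and only the Y q with q beyond [qd d] have
    already moved one step further. *)
Let tau d := y d * M + (M - (qd d).+1).

Hypothesis D_le : N + e <= M ^ 2.

Let a1M : a1 * M <= (N + e).-1.
Proof. exact: leq_trunc_div. Qed.

Let a1_lt : a1 < M.
Proof. by rewrite /a1 ltn_divLR //; move: D_le; rewrite expnS expn1; lia. Qed.

Let pd_le d : d.+1 < n.+1 * N -> pd d <= a1.
Proof.
move=> /(row_pq_lt) h; rewrite /a1 leq_divRL //.
by move: h; lia.
Qed.

Let X_lt p p' : p < p' <= a1 -> X p < X p'.
Proof.
move=> /andP[pp' p'a]; rewrite /X.
suff : p.+1 * M <= p' * M by rewrite mulSn; lia.
by rewrite leq_pmul2r.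
Qed.

Let X_ltN p : X p < N.
Proof. by rewrite /X; lia. Qed.

(** This says 0 <= y d < N. When X p = pM, [Me] absorbs the offset and q; otherwise lowering p by
    one lowers X by 1 but the rows by M. *)
Let X_bound d : d.+1 < n.+1 * N ->
  X (pd d) <= d - kd d * N < N + X (pd d).
Proof.
move=> dT; have pa := pd_le dT; have pq := row_pq_lt dT.
have E := row_eq d; have qM := row_q_lt d.
have o := offset_le (kd d).
have -> : d - kd d * N = offset (kd d) + (pd d * M + qd d) by lia.
move: (offset _) o (pd d) (qd d) pa pq qM {E} => o oN p q pa pq qM.
rewrite /X; apply/andP; split; first by lia.
have [pE|pN] := eqVneq p a1; first by move: a1M; rewrite pE in pq *; lia.
have : (a1 - p) + (M - 1) <= (a1 - p) * M by nia.
by move: a1M; rewrite mulnBl; lia.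
Qed.

Let Y_tau d q : d.+1 < n.+1 * N ->
  Y q (tau d) = minn N.-1 (y d + (q %/ M + (qd d < q %% M))).
Proof.
move=> dT; rewrite /Y /tau; congr minn.
rewrite -addnA divnMDl //; congr (_ + _).
have qM := row_q_lt d.
rewrite {1}(divn_eq q M) addnCA divnMDl //; congr (_ + _).
have := ltn_pmod q M_gt0; move: (q %% M) => r rM.
case: ltnP => h; last by rewrite divn_small //; lia.
rewrite -[X in X %/ _](subnKC (_ : M <= _)); last by lia.
by rewrite -[X in (X + _) %/ _]mul1n divnMDl // divn_small //; lia.
Qed.

Lemma wide_window (F : realFieldType) : exists (k : 'I_(n.+1 * N).-1 -> nat)
    (p q : 'I_(n.+1 * N).-1 -> 'I_M) (A B : 'M[F]_(M, N)),
  (forall d, k d < n) /\ (\det (window_mx k p q A B) != 0)%R.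
Proof.
have dT (d : 'I_(n.+1 * N).-1) : d.+1 < n.+1 * N by have := ltn_ord d; lia.
pose k (d : 'I_(n.+1 * N).-1) := kd d.
pose p (d : 'I_(n.+1 * N).-1) : 'I_M := Ordinal (row_p_lt (dT d) D_le).
pose q (d : 'I_(n.+1 * N).-1) : 'I_M := Ordinal (row_q_lt d).
exists k, p, q.
have kn d : k d < n by exact: row_block_lt.
have N_gt0 : 0 < N by lia.
have [||||||||A [B AB]] := @tropical_window_det_neq0 F M N (n.+1 * N).-1 (N * M) k p q
  (fun p _ => X p) (fun q => Y q) tau N_gt0.
- by move=> d; have := leq_mul (kn d) (leqnn N); rewrite !mulSn; lia.
- by move=> *; exact: X_ltN.
- by move=> *; rewrite /Y; lia.
- by move=> p' a b _ /=; exact: leqnn.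
- by move=> q' a b ab; rewrite /Y; have := @leq_div2r M (a + q') (b + q'); lia.
- move=> d d1; have /X_bound/andP[Xd dX] : d.+1 < n.+1 * N by lia.
  have qM := row_q_lt d.
  have yN : y d < N by rewrite /y; lia.
  by rewrite /tau; have := leq_mul yN (leqnn M); rewrite mulSn; lia.
(* Within a window the strict growth of X outweighs the extra step of Y; between windows the shift N
   outweighs X and that step. *)
- move=> d d' d1 d'd; have dT1 : d.+1 < n.+1 * N by lia.
  rewrite /= Y_tau // divn_small ?modn_small ?row_q_lt // add0n.
  have /andP[Xd dX] := X_bound dT1; have E := row_eq d.
  have yE : kd d * N + X (pd d) + y d = d by rewrite /y; lia.
  rewrite /k; have [kk|[-> pp]|[-> -> qq]] := row_lex_le d'd.
  + have := leq_mul kk (leqnn N); rewrite mulSn; have := X_ltN (pd d'); lia.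
  + have /X_lt : pd d' < pd d <= a1 by rewrite pp pd_le.
    by lia.
  + by lia.
- move=> d d' d1 dd'; have dT1 : d.+1 < n.+1 * N by lia.
  rewrite /= Y_tau // divn_small ?modn_small ?row_q_lt // add0n.
  have /andP[Xd dX] := X_bound dT1; have E := row_eq d.
  have /andP[Xd' dX'] := X_bound (dT d'); have E' := row_eq d'.
  have yE : kd d * N + X (pd d) + y d = d by rewrite /y; lia.
  rewrite /k; have [kk|[kk pp]|[kk ppE qq]] := row_lex_gt dd'.
  + have := leq_mul kk (leqnn N); rewrite mulSn; have := X_ltN (pd d); lia.
  + rewrite kk; have /X_lt : pd d < pd d' <= a1 by rewrite pp pd_le.
    by lia.
  + by rewrite kk ppE in dX' E' *; lia.
- by exists A, B.
Qed.

End wide.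

(** * Staircases when M >= e + 2 *)

Section narrow.
Hypotheses (MN : M <= N) (eM : e.+2 <= M) (D_eq : N + e = M ^ 2).

(* X spacing M.-1, Y spacing 1: the positions of one window are then spread over
   M * M.-1 <= N, so windows do not overlap.  First the Y q increase, Y 0 half a
   step ahead of the others, until th0; then the X p increase, taking turns from
   the largest p down.  Moving Y 0, resp. X p, ahead opens the gap that
   separates the rows (k, p, M.-1) and (k, p.+1, 0). *)
Let th0 := 2 * (N - M).
Let X p th := minn N.-1 (p * M.-1 + (th - th0 + p) %/ M).
Let Y q th := (minn th th0)./2 + maxn q (odd (minn th th0)).
Local Notation kd := row_block.
Local Notation pd := row_p.
Local Notation qd := row_q.
(** As pM + q = p + p(M - 1) + q, row [d] reaches column d once X and Y together have advanced by
    [c d] from p(M - 1) and q. *)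
Let c d := offset (kd d) + pd d.
(** Otherwise the next pair is (p + 1, 0), which would share the position of (p, M - 1); only then
    is a gap needed. *)
Let plain d := (qd d < M.-1) || (pd d == M.-1).
(** Y makes the first N - M steps of the advance, in two magnitudes each; X makes the rest, in M
    magnitudes each. The odd magnitude, resp. the term M - 1 - p, opens the gap. *)
Let tau d :=
  if plain d then if c d <= N - M then 2 * c d else th0 + (c d - (N - M)) * M
  else if c d < N - M then (2 * c d).+1
  else th0 + ((c d - (N - M)) * M + (M.-1 - pd d)).

Let c_le d : d.+1 < n.+1 * N -> c d + e + 2 <= N + M.
Proof.
by move=> /row_p_lt/(_ (eq_leq D_eq)); have := offset_le (kd d); rewrite /c; lia.
Qed.

Let M2 : M.-1 * M.-1 + 2 * M = (N + e).+1.
Proof. by rewrite D_eq expnS expn1 -(prednK M_gt0) /=; nia. Qed.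

Let pM1 p : p * M.-1 + p = p * M.
Proof. by rewrite -mulnSr prednK. Qed.

Let pM1_le p : p < M -> p * M.-1 <= M.-1 * M.-1.
Proof. by move=> pM; rewrite leq_mul2r; apply/orP; right; lia. Qed.

Let X_low p th : p < M -> th <= th0 -> X p th = p * M.-1.
Proof.
move=> pM thth0; rewrite /X (eqP thth0) divn_small // addn0.
by have := pM1_le pM; lia.
Qed.

Let X_high p x r : p < M -> r < M -> x + (M <= r + p) + e <= 2 * M - 2 ->
  X p (th0 + (x * M + r)) = p * M.-1 + x + (M <= r + p).
Proof.
move=> pM rM xM; rewrite /X addKn -addnA divnMDl //.
have -> : (r + p) %/ M = (M <= r + p).
  case: leqP => h; last by rewrite divn_small.
  rewrite -[X in X %/ _](subnKC h).
  by rewrite -[X in (X + _) %/ _]mul1n divnMDl // divn_small //; lia.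
(* By [M2], (M - 1)^2 + (2M - 2 - e) = N - 1, so the cap of X is not exceeded. *)
by have := pM1_le pM; lia.
Qed.

Let pos_tau d p q : d.+1 < n.+1 * N -> p < M -> q < M ->
  X p (tau d) + Y q (tau d) = c d + p * M.-1 +
  if plain d then q else if c d < N - M then maxn q 1 else (pd d < p) + q.
Proof.
move=> dT pM qM; have cd := c_le dT; have pdM := row_p_lt dT (eq_leq D_eq).
have Yhigh t : Y q (th0 + t) = N - M + q.
  by rewrite /Y (minn_idPr (leq_addr _ _)) /th0 mul2n doubleK odd_double maxn0.
rewrite /tau; case: ifPn => [_|].
  case: (leqP (c d)) => cN; last first.
    by rewrite -[_ * M]addn0 X_high // ?add0n ?[M <= p]leqNgt ?pM ?Yhigh ?addn0; lia.
  rewrite X_low //; last by rewrite /th0 leq_mul2l.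
  rewrite /Y (minn_idPl _); last by rewrite /th0 leq_mul2l.
  by rewrite mul2n doubleK odd_double maxn0; lia.
rewrite /plain negb_or => /andP[_ pN]; case: (ltnP (c d)) => cN.
  have cth : (2 * c d).+1 <= th0 by rewrite /th0; lia.
  rewrite X_low // /Y (minn_idPl _) // mul2n /= uphalf_double odd_double /=.
  by lia.
rewrite X_high // ?Yhigh.
- by rewrite (_ : (M <= _) = (pd d < p)); [lia|apply/idP/idP; lia].
- by lia.
- have := leq_b1 (M <= M.-1 - pd d + p); have := offset_le (kd d).
  by rewrite /c in cN *; lia.
Qed.

Lemma narrow_window (F : realFieldType) : exists (k : 'I_(n.+1 * N).-1 -> nat)
    (p q : 'I_(n.+1 * N).-1 -> 'I_M) (A B : 'M[F]_(M, N)),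
  (forall d, k d < n) /\ (\det (window_mx k p q A B) != 0)%R.
Proof.
have dT (d : 'I_(n.+1 * N).-1) : d.+1 < n.+1 * N by have := ltn_ord d; lia.
pose k (d : 'I_(n.+1 * N).-1) := kd d.
pose p (d : 'I_(n.+1 * N).-1) : 'I_M := Ordinal (row_p_lt (dT d) (eq_leq D_eq)).
pose q (d : 'I_(n.+1 * N).-1) : 'I_M := Ordinal (row_q_lt d).
exists k, p, q.
have kn d : k d < n by exact: row_block_lt.
have N_gt0 : 0 < N by lia.
have [||||||||A [B AB]] := @tropical_window_det_neq0 F M N (n.+1 * N).-1
  (th0 + (2 * M - 2 - e) * M).+1 k p q (fun p => X p) (fun q => Y q) tau N_gt0.
- by move=> d; have := leq_mul (kn d) (leqnn N); rewrite !mulSn; lia.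
- by move=> *; rewrite /X; lia.
- by move=> q' th; rewrite /Y /th0; have := ltn_ord q'; lia.
- move=> p' a b ab; rewrite /X leq_min geq_minl (leq_trans (geq_minr _ _)) // leq_add2l.
  by apply: leq_div2r; rewrite leq_add2r leq_sub2r.
- move=> q' a b ab; rewrite /Y; have : minn a th0 <= minn b th0 by lia.
  by move: (minn a _) (minn b _); lia.
- move=> d d1; have dT1 : d.+1 < n.+1 * N by lia.
  have cd := c_le dT1; have pdM := row_p_lt dT1 (eq_leq D_eq).
  rewrite ltnS /tau; case: ifPn => [_|].
    case: (leqP (c d)) => cN.
      by rewrite (leq_trans _ (leq_addr _ _)) // /th0; lia.
    by rewrite leq_add2l leq_mul2r; apply/orP; right; lia.
  rewrite /plain negb_or => /andP[_ pN]; case: (ltnP (c d)) => cN.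
    by rewrite (leq_trans _ (leq_addr _ _)) // /th0; lia.
  rewrite leq_add2l; have : (c d - (N - M)).+1 <= 2 * M - 2 - e.
    by have := offset_le (kd d); rewrite /c in cN *; lia.
  by move=> /leq_mul/(_ (leqnn M)); rewrite mulSn; lia.
- move=> d d' d1 d'd; have dT1 : d.+1 < n.+1 * N by lia.
  have pdM := row_p_lt dT1 (eq_leq D_eq); have qdM := row_q_lt d.
  have pd'M := row_p_lt (dT d') (eq_leq D_eq); have qd'M := row_q_lt d'.
  rewrite /= -addnA pos_tau // /k.
  have E := row_eq d; have pE := pM1 (pd d).
  have pE' := pM1 (pd d'); have pd'le := pM1_le pd'M.
  have pp : pd d <= pd d * M by rewrite leq_pmulr.
  move: pE pE'.
  rewrite /plain /c; have [kk|[-> ppd]|[-> -> qq]] := row_lex_le d'd.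
  + have := leq_mul kk (leqnn N); rewrite mulSn.
    by case: ifP; [lia|move=> /negbT; rewrite negb_or; case: ifP; lia].
  + have := leq_mul ppd (leqnn M.-1); rewrite mulSn.
    by case: ifP; [lia|move=> /negbT; rewrite negb_or; case: ifP; lia].
  + by case: ifP; [lia|move=> /negbT; rewrite negb_or; case: ifP; lia].
- move=> d d' d1 dd'; have dT1 : d.+1 < n.+1 * N by lia.
  have pdM := row_p_lt dT1 (eq_leq D_eq); have qdM := row_q_lt d.
  have pd'M := row_p_lt (dT d') (eq_leq D_eq); have qd'M := row_q_lt d'.
  rewrite /= -addnA pos_tau // /k.
  have E := row_eq d; have pE := pM1 (pd d).
  have pE' := pM1 (pd d'); have ple := pM1_le pdM.
  move: pE pE'.
  rewrite /plain /c; have [kk|[-> ppd]|[-> -> qq]] := row_lex_gt dd'.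
  + have := leq_mul kk (leqnn N); rewrite mulSn.
    have := leq0n (pd d' * M.-1).
    by case: ifP; [lia|move=> /negbT; rewrite negb_or; case: ifP; lia].
  + have := leq_mul ppd (leqnn M.-1); rewrite mulSn.
    by case: ifP; [lia|move=> /negbT; rewrite negb_or; case: ifP; lia].
  + by case: ifP; [lia|move=> /negbT; rewrite negb_or; case: ifP; lia].
- by exists A, B.
Qed.

End narrow.

End rows.

Lemma regular_window (F : realFieldType) (M N n : nat) :
  (0 < M)%N -> (M <= N)%N -> (0 < n)%N -> (n.+1 * N <= (n * M ^ 2).+1)%N ->
  exists (k : 'I_(n.+1 * N).-1 -> nat) (p q : 'I_(n.+1 * N).-1 -> 'I_M)
    (A B : 'M[F]_(M, N)),
  (forall d, k d < n)%N /\ \det (window_mx k p q A B) != 0.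
Proof.
(* A block has at most M^2 pairs (p, q), and a window meets 2N - 1 columns: N + e is the smaller
   number. *)
move=> M_gt0 MN n_gt0 nM; pose e := (minn (M ^ 2) (N * 2 - 1) - N)%N.
have NM : (N <= M ^ 2)%N by nia.
have e_lt : (e < N)%N by rewrite /e; lia.
have ne : (N <= (n * e).+1)%N by rewrite /e; nia.
have [Me|eM] := leqP M e.+1.
  by apply: (wide_window M_gt0 n_gt0 e_lt ne) => //; rewrite /e; lia.
(* Here e + 2 <= M <= N, so the minimum is M^2. *)
by apply: (narrow_window M_gt0 n_gt0 e_lt ne) => //; move: eM; rewrite /e; lia.
Qed.

(** * Real zeros of polynomial functions *)

(** Polynomial functions as an inductive predicate: slicing and measurability follow by induction on
    the construction. *)
Inductive polyfun (C : pzRingType) (n : nat) : (n.-tuple C -> C) -> Prop :=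
| polyfun_cst c : polyfun (fun=> c)
| polyfun_tnth i : polyfun (fun t => tnth t i)
| polyfunD f g : polyfun f -> polyfun g -> polyfun (fun t => f t + g t)
| polyfunM f g : polyfun f -> polyfun g -> polyfun (fun t => f t * g t).

Lemma polyfun_sum (C : pzRingType) n (I : Type) (r : seq I) (P : pred I)
    (f : I -> n.-tuple C -> C) :
  (forall i, polyfun (f i)) -> polyfun (fun t => \sum_(i <- r | P i) f i t).
Proof.
move=> pf; elim: r => [|i r IH].
  under [X in polyfun X]eq_fun do rewrite big_nil; exact: polyfun_cst.
under [X in polyfun X]eq_fun do rewrite big_cons.
by case: (P i) => //; exact: polyfunD.
Qed.

Lemma polyfun_prod (C : pzRingType) n (I : Type) (r : seq I) (P : pred I)
    (f : I -> n.-tuple C -> C) :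
  (forall i, polyfun (f i)) -> polyfun (fun t => \prod_(i <- r | P i) f i t).
Proof.
move=> pf; elim: r => [|i r IH].
  under [X in polyfun X]eq_fun do rewrite big_nil; exact: polyfun_cst.
under [X in polyfun X]eq_fun do rewrite big_cons.
by case: (P i) => //; exact: polyfunM.
Qed.

Lemma polyfun_det (C : comPzRingType) n m (A : n.-tuple C -> 'M[C]_m) :
  (forall i j, polyfun (fun t => A t i j)) -> polyfun (fun t => \det (A t)).
Proof.
move=> pA; apply: polyfun_sum => s; apply: polyfunM; first exact: polyfun_cst.
by apply: polyfun_prod => i; exact: pA.
Qed.

Lemma polyfun_head (C : comNzRingType) n (f : n.+1.-tuple C -> C) (t : n.-tuple C) :
  polyfun f -> exists p : {poly C}, forall x, f [tuple of x :: t] = p.[x].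
Proof.
elim=> [c|i|g h _ [p gp] _ [q hq]|g h _ [p gp] _ [q hq]].
- by exists c%:P => x; rewrite hornerC.
- case: (unliftP ord0 i) => [j|] ->.
    by exists (tnth t j)%:P => x; rewrite tnthS hornerC.
  by exists 'X => x; rewrite tnth0 hornerX.
- by exists (p + q) => x; rewrite gp hq hornerD.
- by exists (p * q) => x; rewrite gp hq hornerM.
Qed.

Lemma polyfun_behead (C : pzRingType) n (f : n.+1.-tuple C -> C) (x : C) :
  polyfun f -> polyfun (fun t : n.-tuple C => f [tuple of x :: t]).
Proof.
elim=> [c|i|g h _ pg _ ph|g h _ pg _ ph].
- exact: polyfun_cst.
- case: (unliftP ord0 i) => [j|] ->.
    by under [X in polyfun X]eq_fun do rewrite tnthS; exact: polyfun_tnth.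
  by under [X in polyfun X]eq_fun do rewrite tnth0; exact: polyfun_cst.
- exact: polyfunD.
- exact: polyfunM.
Qed.

Section real_zeros.
Variable R : realType.

Definition complex_tuple n (t : n.-tuple (measurableTypeR R)) : n.-tuple R[i] :=
  [tuple of map (real_complex R) t].

Lemma measurable_polyfun n (f : n.-tuple R[i] -> R[i]) : polyfun f ->
  measurable_fun setT (fun t => complex.Re (f (complex_tuple t)) : measurableTypeR R) /\
  measurable_fun setT (fun t => complex.Im (f (complex_tuple t)) : measurableTypeR R).
Proof.
elim=> [c|i|g h _ [mg1 mg2] _ [mh1 mh2]|g h _ [mg1 mg2] _ [mh1 mh2]].
- by split; exact: measurable_cst.
- split; under eq_fun do rewrite tnth_map /=; last exact: measurable_cst.
  exact: measurable_tnth.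
- by split; under eq_fun do rewrite raddfD /=; exact: measurable_funD.
- have ReM (x y : R[i]) : complex.Re (x * y) =
      complex.Re x * complex.Re y - complex.Im x * complex.Im y.
    by case: x y => [? ?] [? ?].
  have ImM (x y : R[i]) : complex.Im (x * y) =
      complex.Re x * complex.Im y + complex.Im x * complex.Re y.
    by case: x y => [? ?] [? ?].
  split.
    under eq_fun do rewrite ReM.
    by apply: measurable_funB; exact: measurable_funM.
  under eq_fun do rewrite ImM.
  by apply: measurable_funD; exact: measurable_funM.
Qed.

Lemma measurable_polyfun_zeros n (f : n.-tuple R[i] -> R[i]) : polyfun f ->
  measurable [set t | f (complex_tuple t) = 0].
Proof.
move=> /measurable_polyfun[mRe mIm].
rewrite (_ : mkset _ =
  ((fun t => complex.Re (f (complex_tuple t)) : measurableTypeR R) @^-1` [set 0]) `&`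
  ((fun t => complex.Im (f (complex_tuple t)) : measurableTypeR R) @^-1` [set 0])).
  apply: measurableI; rewrite -[X in measurable X]setTI.
    by apply: mRe => //; exact: measurable_set1.
  by apply: mIm => //; exact: measurable_set1.
apply/seteqP; split=> t /=; first by move=> ->.
by case: (f _) => x y /= [-> ->].
Qed.

(** Fubini and induction on the number of variables. The point [t0] may be complex although the
    zeros measured are real. *)
Lemma polyfun_zeros_null n (f : n.-tuple R[i] -> R[i]) (t0 : n.-tuple R[i]) :
  polyfun f -> f t0 != 0 ->
  lebesgue_tuple R n [set t | f (complex_tuple t) = 0] = 0%E.
Proof.
elim: n f t0 => [|n IH] f t0 pf ft0.
  rewrite /= diracE memNset // => /=; rewrite (tuple0 (complex_tuple _)) -(tuple0 t0).
  exact/eqP.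
have mZ := measurable_polyfun_zeros pf.
rewrite /= /lebesgue_cons /pushforward.
set Z := (X in (_ \x _)%E X).
have mZ' : measurable Z.
  by rewrite -[X in measurable X]setTI; exact: measurable_tuple_cons.
have consE x t : complex_tuple (@tuple_cons R n (x, t)) =
    [tuple of x%:C :: complex_tuple t].
  exact/val_inj.
have t0E : t0 = [tuple of thead t0 :: [tuple of behead t0]] by exact: tuple_eta.
have [p fp] := polyfun_head [tuple of behead t0] pf.
have p_neq0 : p != 0.
  by apply: contraNneq ft0 => p0; rewrite t0E fp p0 horner0.
(* Outside these finitely many x, the slice at x is nonzero at the tail of [t0], so the induction
   hypothesis applies. *)
pose N : set (measurableTypeR R) := [set x | root p x%:C].
have finN : finite_set N.
  have [r pr] := closed_field_poly_normal p.
  apply: (@sub_finite_set _ _ [set` map (@complex.Re R) r]); last exact: finite_seq.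
  move=> x /=; rewrite /N /= pr rootZ ?lead_coef_eq0 // root_prod_XsubC => xr.
  by apply/mapP; exists x%:C.
have mN : measurable N.
  apply: countable_measurable => [x|]; first exact: measurable_set1.
  by exact: finite_set_countable.
rewrite /product_measure1 (ge0_negligible_integral mN) //.
- apply: integral0_eq => x [_ xN]; rewrite /=.
  rewrite (_ : xsection Z x = [set t | f [tuple of x%:C :: complex_tuple t] = 0]).
    apply: (IH (fun t => f [tuple of x%:C :: t]) [tuple of behead t0]).
      exact: polyfun_behead.
    by rewrite fp; exact/negP.
  by apply/seteqP; split=> t; rewrite /xsection /= inE /Z /= consE.
- exact: measurable_fun_xsection.
- by apply: countable_lebesgue_measure0; exact: finite_set_countable.
Qed.

End real_zeros.

(** * Compressions of Toeplitz matrices *)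

Lemma toeplitz_seq (C : Type) (c0 : C) n (A : 'M[C]_n) : toeplitz A ->
  exists t : nat -> C, forall i j, A i j = t (i + (n.-1 - j))%N.
Proof.
case: n A => [|n] A tA; first by exists (fun=> c0) => -[].
(* Truncated subtraction picks the entry of the diagonal in the first row or column; [c0] serves the
   empty matrix only. *)
exists (fun d => A (inord (d - n)) (inord (n - d))) => i j /=.
have := ltn_ord i; have := ltn_ord j => jn ik.
by apply: tA; rewrite !inordK; lia.
Qed.

Lemma seq_toeplitz (C : Type) n (A : 'M[C]_n) (t : nat -> C) :
  (forall i j : 'I_n, A i j = t (i + (n.-1 - j))%N) -> toeplitz A.
Proof.
move=> At i j i' j' ij; rewrite !At; congr t.
by have := ltn_ord j; have := ltn_ord j'; lia.
Qed.

Lemma sum_mxtens (V : nmodType) m n (f : 'I_(m * n) -> V) :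
  \sum_u f u = \sum_a \sum_i f (mxtens_index (a, i)).
Proof.
rewrite pair_big /= (reindex (@mxtens_index m n)) /=; last first.
  apply: onW_bij; exists (@mxtens_unindex m n).
    exact: mxtens_indexK.
  exact: mxtens_unindexK.
by apply: eq_bigr => -[a i].
Qed.

Section windows.
Context {R : realType} (M N : nat).
Implicit Types (F : 'M[R[i]]_(M, N)) (t : nat -> R[i]).

(** Reversal turns the Toeplitz difference i - j into a sum, hence the compression into a product of
    polynomials. *)
Definition conj_rev F : 'M[R[i]]_(M, N) := \matrix_(q, j) (F q (rev_ord j))^*%R.

Definition window_form F t (k : nat) (p q : 'I_M) : R[i] :=
  \sum_(ij : 'I_N * 'I_N) F p ij.1 * conj_rev F q ij.2 * t (k * N + ij.1 + ij.2)%N.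

(** I (x) Phi acts blockwise, and the block (a, b) of a Toeplitz matrix depends only on a - b. *)
Lemma compression_entry B F (A : 'M[R[i]]_(B * N)) t :
  (forall u v, A u v = t (u + ((B * N).-1 - v))%N) ->
  forall (a b : 'I_B) (p q : 'I_M),
  compression ((1%:M : 'M[R[i]]_B) *t F) A
    (mxtens_index (a, p)) (mxtens_index (b, q)) =
  window_form F t (a + (B.-1 - b)) p q.
Proof.
move=> At a b p q; rewrite /compression !mxE sum_mxtens (bigD1 b) //=.
rewrite [X in _ + X]big1 ?addr0; last first.
  move=> c cb; rewrite big1 // => j _.
  by rewrite !mxE !mxtens_indexK /= eq_sym (negPf cb) mul0r rmorph0 mulr0.
rewrite (reindex_inj rev_ord_inj) /= /window_form.
rewrite -(pair_big xpredT xpredT (fun i j => F p i * conj_rev F q j *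
   t ((a + (B.-1 - b)) * N + i + j)%N)) /= exchange_big /=.
apply: eq_bigr => j _; rewrite !mxE !mxtens_indexK /= eqxx mul1r sum_mxtens.
rewrite (bigD1 a) //= [X in _ + X]big1 ?addr0; last first.
  move=> c ca; rewrite big1 // => i _.
  by rewrite !mxE !mxtens_indexK /= eq_sym (negPf ca) !mul0r.
rewrite mulr_suml; apply: eq_bigr => i _.
rewrite !mxE !mxtens_indexK /= eqxx mul1r At mulrAC; congr (_ * _ * t _).
have aB := ltn_ord a; have bB := ltn_ord b; have iN := ltn_ord i; have jN := ltn_ord j.
rewrite /= mulnDl mulnBl.
rewrite -[X in (X * N).-1](prednK (leq_ltn_trans (leq0n _) aB)) mulSn.
have : (b * N <= B.-1 * N)%N by rewrite leq_mul2r; apply/orP; right; lia.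
by move: (B.-1 * N)%N (b * N)%N (a * N)%N => x y z; lia.
Qed.

Lemma window_mx_col n (k : 'I_(n.+1 * N).-1 -> nat)
    (p q : 'I_(n.+1 * N).-1 -> 'I_M) F t d :
  (k d < n)%N ->
  (window_mx k p q F (conj_rev F) *m \col_d' t d') d 0 =
  window_form F t (k d) (p d) (q d).
Proof.
move=> kn; rewrite mxE /window_form.
under eq_bigr => d' _ do rewrite !mxE mulr_suml.
rewrite (exchange_big_dep xpredT) //=; apply: eq_bigr => -[i j] _ /=.
have dT : (k d * N + i + j < (n.+1 * N).-1)%N.
  have := leq_mul kn (leqnn N); have := ltn_ord i; have := ltn_ord j.
  by rewrite !mulSn; lia.
by rewrite (big_pred1 (Ordinal dT)) // => d'; rewrite -val_eqE /= eq_sym.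
Qed.

Lemma toeplitz_compression_inj B n F (k : 'I_(n.+1 * N).-1 -> nat)
    (p q : 'I_(n.+1 * N).-1 -> 'I_M) :
  n.+1 = (2 * B)%N -> (forall d, k d < n)%N ->
  \det (window_mx k p q F (conj_rev F)) != 0 ->
  forall A, toeplitz A -> compression ((1%:M : 'M[R[i]]_B) *t F) A = 0 -> A = 0.
Proof.
move=> nB kn detW A /(toeplitz_seq 0)[t At] FA.
have /(congr1 (mulmx (invmx (window_mx k p q F (conj_rev F))))) :
    window_mx k p q F (conj_rev F) *m (\col_d t d) = 0.
  apply/colP => d; rewrite window_mx_col // [RHS]mxE.
  (* A block (a, b) with a + (B - 1 - b) = k. *)
  have aB : (minn (k d) B.-1 < B)%N by have := kn d; lia.
  have bB : (B.-1 - (k d - minn (k d) B.-1) < B)%N by have := kn d; lia.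
  have := compression_entry F At (Ordinal aB) (Ordinal bB) (p d) (q d).
  rewrite FA mxE /= (_ : (_ + _)%N = k d) //; have := kn d; lia.
rewrite mulmx0 mulKmx ?unitmxE ?unitfE // => /colP t0.
apply/matrixP => u v; rewrite At mxE.
have dT : (u + ((B * N).-1 - v) < (n.+1 * N).-1)%N.
  by have := ltn_ord u; have := ltn_ord v; rewrite nB -mulnA; lia.
by have := t0 (Ordinal dT); rewrite !mxE.
Qed.

End windows.

(** * Universality and injectivity on Toeplitz matrices *)

Section samplers.
Context {R : realType} {K L : nat}.
Implicit Type F : 'M[R[i]]_(K, L).

Lemma compression_sum F k (c : 'I_k -> R) (V : 'I_k -> 'M[R[i]]_L) :
  compression F (\sum_l (c l)%:C *: V l) =
  \sum_l (c l)%:C *: compression F (V l).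
Proof.
rewrite /compression mulmx_sumr mulmx_suml; apply: eq_bigr => l _.
by rewrite -scalemxAr -scalemxAl.
Qed.

Lemma compressionB F A A' :
  compression F (A - A') = compression F A - compression F A'.
Proof. by rewrite /compression mulmxBr mulmxBl. Qed.

Lemma compression_hermsymmx F A :
  A \is hermsymmx -> compression F A \is hermsymmx.
Proof.
move=> /is_hermitianmxP; rewrite expr0 scale1r => AE.
apply/is_hermitianmxP; rewrite expr0 scale1r /compression !trmx_mul !map_mxM.
have -> : map_mx Num.conj ((F ^t*)^T)%R = F.
  by apply/matrixP => i j; rewrite !mxE conjCK.
by rewrite -AE mulmxA.
Qed.

Lemma toeplitz_linear (a : R[i]) (A A' : 'M[R[i]]_L) :
  toeplitz A -> toeplitz A' -> toeplitz (a *: A + A').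
Proof.
move=> tA tA' i j i' j' ij.
by rewrite !mxE (tA _ _ _ _ ij) (tA' _ _ _ _ ij).
Qed.

Lemma universal_of_inj F :
  (forall A, toeplitz A -> compression F A = 0 -> A = 0) ->
  universal_covariance_sampler F.
Proof.
move=> injF S ST _.
have tspan A : real_span S A -> toeplitz A.
  move=> [k [c [V [SV ->]]]]; elim/big_rec: _ => [|l A' _ tA'].
    by move=> i j i' j' _; rewrite !mxE.
  by apply: toeplitz_linear => //; have [] := ST _ (SV l).
split.
- move=> A [k [c [V [SV ->]]]]; exists k, c, (fun l => compression F (V l)).
  split; first by move=> l; exists (V l).
  exact: compression_sum.
- move=> A A'; rewrite !inE => /tspan tA /tspan tA' FAA'.
  apply/eqP; rewrite -subr_eq0; apply/eqP; apply: injF.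
    by rewrite addrC -scaleN1r; exact: toeplitz_linear.
  by rewrite compressionB FAA' subrr.
- move=> _ [k [c [W [SW ->]]]].
  have /choice[V VW] : forall l, exists V, S V /\ compression F V = W l.
    by move=> l; have [V SV VW] := SW l; exists V.
  exists (\sum_l (c l)%:C *: V l).
    by exists k, c, V; split=> // l; have [] := VW l.
  by rewrite compression_sum; apply: eq_bigr => l _; have [_ <-] := VW l.
Qed.

(** If A were nonzero, the singleton {A} would be free, and injectivity on its span would separate A
    from 0. *)
Lemma universal_inj F (A : 'M[R[i]]_L) : universal_covariance_sampler F ->
  A \is hermsymmx -> toeplitz A -> compression F A = 0 -> A = 0.
Proof.
move=> uF hA tA FA; apply/eqP/negPn/negP => A_neq0.
have cplx_eq0 (c : R) : c%:C *: A = 0 -> c = 0.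
  move=> /eqP; rewrite scaler_eq0 (negPf A_neq0) orbF => /eqP/complexI; exact.
have [||_ /(_ A 0) inj _] := uF [set A].
- by move=> _ ->.
- move=> k c V Vinj SV sum0 l; apply: cplx_eq0; rewrite -[RHS]sum0 (bigD1 l) //=.
  rewrite SV big1 ?addr0 // => l' l'l; case/eqP: l'l; apply: Vinj.
  by rewrite (SV l) (SV l').
- have A0 : A = 0; last by rewrite A0 eqxx in A_neq0.
  apply: inj; rewrite ?inE.
  + exists 1%N, (fun=> 1), (fun=> A); split=> //.
    by rewrite big_ord1 scale1r.
  + by exists 0%N, (fun=> 0), (fun=> A); split=> [[]//|]; rewrite big_ord0.
  + by rewrite FA /compression mulmx0 mul0mx.
Qed.

End samplers.

(** Hermitian Toeplitz matrices have 2BN - 1 real parameters, and (2B - 1) M^2 real linear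
    conditions make the Hermitian compression vanish. *)
Lemma hermitian_toeplitz_kernel (R : realType) (M N B : nat)
    (F : 'M[R[i]]_(M, N)) :
  (0 < N)%N -> (0 < B)%N -> ((2 * B).-1 * M ^ 2 < (2 * B * N).-1)%N ->
  exists A : 'M[R[i]]_(B * N), [/\ A \is hermsymmx, toeplitz A,
    compression ((1%:M : 'M[R[i]]_B) *t F) A = 0 & A != 0].
Proof.
move=> N0 B0; set n := (2 * B).-1; set L := (B * N).-1 => MT.
have BN : (B * N = L.+1)%N by rewrite prednK // muln_gt0 B0.
(* On the opposite diagonal [L.*2 - d] the value is the conjugate one, while c ranges over all real
   vectors. *)
pose s (c : 'rV[R]_(L.*2.+1)) d : R[i] :=
  (c 0 (inord d) + c 0 (inord (L.*2 - d))) +i*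
  (c 0 (inord d) - c 0 (inord (L.*2 - d))).
(* phi z = phi z^* = 0 forces z = 0, so on Hermitian matrices phi loses
   nothing. *)
pose phi (z : R[i]) : R := complex.Re z + complex.Im z.
pose f (c : 'rV[R]_(L.*2.+1)) : 'rV[R]_#|{: 'I_n * 'I_M * 'I_M}| :=
  \row_(x < #|{: 'I_n * 'I_M * 'I_M}|)
    phi (window_form F (s c) (enum_val x).1.1 (enum_val x).1.2 (enum_val x).2).
have phiD : {morph phi : x y / x + y} by move=> [? ?] [? ?]; rewrite /phi /=; ring.
have phiZ a z : phi (a%:C * z) = a * phi z by case: z => ? ?; rewrite /phi /=; ring.
have f_lin : linear f.
  move=> a c c'; apply/rowP => x; rewrite !mxE; case: (enum_val x) => [[k p] q] /=.
  rewrite -phiZ -phiD /window_form mulr_sumr -big_split /=; congr phi.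
  apply: eq_bigr => ij _; rewrite mulrCA -mulrDr; congr (_ * _).
  rewrite /s !mxE; apply/eqP; rewrite eq_complex /=.
  by apply/andP; split; apply/eqP; ring.
pose lf : {linear 'rV[R]_(L.*2.+1) -> 'rV[R]_#|{: 'I_n * 'I_M * 'I_M}|} :=
  HB.pack f (GRing.isLinear.Build _ _ _ _ f f_lin).
have : kermx (lin1_mx lf) != 0.
  rewrite -mxrank_eq0 mxrank_ker subn_eq0 -ltnNge.
  apply: leq_ltn_trans (rank_leq_col _) _.
  by rewrite !card_prod !card_ord -mulnA mulnn; move: MT; rewrite -mulnA BN; lia.
case/rowV0Pn => c /sub_kermxP; rewrite mul_rV_lin1 /= => fc c_neq0.
pose A : 'M[R[i]]_(B * N) := \matrix_(u, v) s c (u + (L - v))%N.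
exists A.
have At u v : A u v = s c (u + ((B * N).-1 - v))%N.
  by rewrite mxE.
have herm : A \is hermsymmx.
  apply/is_hermitianmxP; rewrite expr0 scale1r; apply/matrixP => u v.
  have uL : (u <= L)%N by have := ltn_ord u; rewrite [X in (_ < X)%N]BN.
  have vL : (v <= L)%N by have := ltn_ord v; rewrite [X in (_ < X)%N]BN.
  rewrite !mxE /s (_ : L.*2 - (v + (L - u)) = u + (L - v))%N; last by lia.
  rewrite (_ : L.*2 - (u + (L - v)) = v + (L - u))%N; last by lia.
  by apply/eqP; rewrite eq_complex /= addrC opprB !eqxx.
split=> //; first exact: seq_toeplitz At.
- set G := compression _ _.
  have phiG u v : phi (G u v) = 0.
    case: (mxtens_indexP u) => a p; case: (mxtens_indexP v) => b q.
    rewrite (compression_entry F At).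
    have kn : (a + (B.-1 - b) < n)%N.
      by have := ltn_ord a; have := ltn_ord b; rewrite /n; lia.
    pose x := enum_rank (Ordinal kn, p, q).
    have := congr1 (fun r : 'rV[R]_#|{: 'I_n * 'I_M * 'I_M}| => r 0 x) fc.
    by rewrite !mxE enum_rankK.
  have hermG u v : G u v = (G v u)^*%R.
    have /is_hermitianmxP := compression_hermsymmx (1%:M *t F) herm.
    by rewrite expr0 scale1r => /matrixP/(_ u v) GE; rewrite {1}/G GE !mxE.
  apply/matrixP => u v; rewrite [RHS]mxE; have := phiG u v; have := phiG v u.
  rewrite (hermG u v); case: (G v u) => x y; rewrite /phi /= => xy xNy.
  by apply/eqP; rewrite eq_complex /=; apply/andP; split; apply/eqP; lra.
- apply: contraNneq c_neq0 => A0; apply/eqP/rowP => d; rewrite mxE.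
  have dL := ltn_ord d; have uB : (d - L < B * N)%N by lia.
  have vB : (L - d < B * N)%N by lia.
  have := At (Ordinal uB) (Ordinal vB); rewrite A0 mxE /= -/L.
  rewrite (_ : (d - L + (L - (L - d)) = d)%N); last by lia.
  move=> /esym/eqP; rewrite eq_complex /= inord_val => /andP[/eqP cd /eqP cNd].
  lra.
Qed.

(** * Generic sampling matrices *)

Section generic.
Context {R : realType} (M N : nat).

(* For real t, the second matrix is conj_rev of the first; for complex t they are
   unrelated (coords_surj). *)
Definition coords_mx (t : (M * N + M * N).-tuple R[i]) : 'M[R[i]]_(M, N) :=
  \matrix_(p, i) (tnth t (lshift _ (mxvec_index p i))
    + 'i * tnth t (rshift _ (mxvec_index p i))).

Definition coords_conj_rev (t : (M * N + M * N).-tuple R[i]) : 'M[R[i]]_(M, N) :=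
  \matrix_(p, i) (tnth t (lshift _ (mxvec_index p (rev_ord i)))
    + - 'i * tnth t (rshift _ (mxvec_index p (rev_ord i)))).

Lemma complex_tuple_coords (F : 'M[R[i]]_(M, N)) p i :
  let t := complex_tuple (mx_coords F) in
  tnth t (lshift _ (mxvec_index p i)) = (complex.Re (F p i))%:C /\
  tnth t (rshift _ (mxvec_index p i)) = (complex.Im (F p i))%:C.
Proof.
by rewrite /complex_tuple !tnth_map tnth_lshift tnth_rshift !tnth_mktuple mxvecE.
Qed.

Lemma coords_mxK (F : 'M[R[i]]_(M, N)) : coords_mx (complex_tuple (mx_coords F)) = F.
Proof.
apply/matrixP => p i; rewrite mxE; have [-> ->] := complex_tuple_coords F p i.
by rewrite -complexE.
Qed.

Lemma coords_conj_revK (F : 'M[R[i]]_(M, N)) :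
  coords_conj_rev (complex_tuple (mx_coords F)) = conj_rev F.
Proof.
apply/matrixP => p i; rewrite !mxE.
have [-> ->] := complex_tuple_coords F p (rev_ord i).
case: (F _ _) => x y; apply/eqP; rewrite eq_complex /=.
by apply/andP; split; apply/eqP; ring.
Qed.

Lemma coords_surj (A B : 'M[R[i]]_(M, N)) :
  exists t, coords_mx t = A /\ coords_conj_rev t = B.
Proof.
(* U and V solve U + iV = A and U - iV = B, up to the reversal of columns in B. *)
pose U : 'M[R[i]]_(M, N) := \matrix_(p, i) (2^-1 * (A p i + B p (rev_ord i))).
pose V : 'M[R[i]]_(M, N) := \matrix_(p, i) ((2 * 'i)^-1 * (A p i - B p (rev_ord i))).
have half (K : numFieldType) (z x y : K) : z != 0 ->
    2^-1 * (x + y) + z * ((2 * z)^-1 * (x - y)) = x /\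
    2^-1 * (x + y) - z * ((2 * z)^-1 * (x - y)) = y.
  by move=> z0; split; field.
have i0 : ('i : R[i]) != 0 by rewrite eq_complex /= oner_eq0 andbF.
have tnth_row m n (u : 'rV[R[i]]_m) (v : 'rV[R[i]]_n) k l :
    tnth [tuple row_mx u v 0 j | j < m + n] (lshift n k) = u 0 k /\
    tnth [tuple row_mx u v 0 j | j < m + n] (rshift m l) = v 0 l.
  by rewrite !tnth_mktuple row_mxEl row_mxEr.
exists [tuple row_mx (mxvec U) (mxvec V) 0 k | k < M * N + M * N].
split; apply/matrixP => p i; rewrite mxE.
  pose k := mxvec_index p i.
  have [-> ->] := tnth_row _ _ (mxvec U) (mxvec V) k k.
  rewrite !mxvecE [U _ _]mxE [V _ _]mxE.
  by have [] := half _ _ (A p i) (B p (rev_ord i)) i0.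
pose k := mxvec_index p (rev_ord i).
have [-> ->] := tnth_row _ _ (mxvec U) (mxvec V) k k.
rewrite !mxvecE [U _ _]mxE [V _ _]mxE rev_ordK mulNr.
by have [] := half _ _ (A p (rev_ord i)) (B p i) i0.
Qed.

Lemma polyfun_window_det T (k : 'I_T -> nat) (p q : 'I_T -> 'I_M) :
  polyfun (fun t => \det (window_mx k p q (coords_mx t) (coords_conj_rev t))).
Proof.
apply: polyfun_det => d d'; under [X in polyfun X]eq_fun do rewrite mxE.
apply: polyfun_sum => ij.
apply: polyfunM; under [X in polyfun X]eq_fun do rewrite mxE;
  (apply: polyfunD; [exact: polyfun_tnth|apply: polyfunM]);
  by [exact: polyfun_cst|exact: polyfun_tnth].
Qed.

Lemma map_window_mx T (k : 'I_T -> nat) (p q : 'I_T -> 'I_M)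
    (A B : 'M[R]_(M, N)) :
  window_mx k p q (map_mx (real_complex R) A) (map_mx (real_complex R) B) =
  map_mx (real_complex R) (window_mx k p q A B).
Proof.
apply/matrixP => d d'; rewrite !mxE rmorph_sum; apply: eq_bigr => ij _.
by rewrite !mxE rmorphM.
Qed.

End generic.

(** * The bound on M and the equivalence *)

Lemma sqrt_bound (R : realType) (M N B : nat) : (0 < N)%N -> (0 < B)%N ->
  (Num.sqrt (((2 * N * B)%:R - 1) / ((2 * B)%:R - 1)) <= M%:R :> R) =
  (2 * B * N <= ((2 * B).-1 * M ^ 2).+1)%N.
Proof.
move=> N0 B0; have [n nB] : exists n, (2 * B = n.+2)%N by exists (2 * B - 2)%N; lia.
rewrite -[M%:R]ger0_norm // -sqrtr_sqr ler_sqrt ?sqr_ge0 // mulnAC nB.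
rewrite -[n.+2%:R - 1]/(n.+2%:R - 1%:R) -natrB // subn1 /=.
rewrite ler_pdivrMr ?ltr0Sn // lerBlDr -natrX -natrM.
by rewrite natr1 ler_nat (mulnC (M ^ 2)%N).
Qed.

Lemma ae_exists d (T : measurableType d) (R : realType) (P : probability T R)
    (Q : T -> Prop) :
  {ae P, forall w, Q w} -> exists w, Q w.
Proof.
move=> [A [mA A0 QA]]; apply: contrapT => nQ.
have AT : A = setT.
  by apply/seteqP; split=> // w _; apply: QA => Qw; apply: nQ; exists w.
by move: A0; rewrite AT probability_setT => /eqP; rewrite onee_eq0.
Qed.

Theorem theorem5 (R : realType) (d : measure_display) (T : measurableType d)
    (P : probability T R) (M N B : nat) (Phi : T -> 'M[R[i]]_(M, N)) :
  (0 < M)%N -> (M <= N)%N -> (0 < B)%N ->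
  random_mx Phi -> continuous_distribution P Phi ->
  ({ae P, forall w, universal_covariance_sampler ((1%:M : 'M[R[i]]_B) *t Phi w)}
   <-> Num.sqrt (((2 * N * B)%:R - 1) / ((2 * B)%:R - 1)) <= M%:R :> R).
Proof.
move=> M0 MN B0 mPhi cPhi; have N0 : (0 < N)%N by exact: leq_trans MN.
(* An almost sure property holds at some w, while below the bound a kernel matrix excludes every
   [Phi w]. *)
rewrite sqrt_bound //; split=> [/ae_exists[w uw]|MNB].
  rewrite leqNgt; apply/negP => lt.
  have [|A [hA tA FA /eqP]] := @hermitian_toeplitz_kernel R M N B (Phi w) N0 B0.
    by move: lt; lia.
  by apply; exact: universal_inj uw hA tA FA.
set n := (2 * B).-1 in MNB; have nB : n.+1 = (2 * B)%N by rewrite /n; lia.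
have n0 : (0 < n)%N by rewrite /n; lia.
have [|k [p [q [A0 [B1 [kn detAB]]]]]] := @regular_window R M N n M0 MN n0.
  by rewrite nB.
have [t0 [t0A t0B]] := coords_surj
  (map_mx (real_complex R) A0) (map_mx (real_complex R) B1).
have pQ := @polyfun_window_det R M N _ k p q.
have mZ := measurable_polyfun_zeros pQ.
have Q0 : \det (window_mx k p q (coords_mx t0) (coords_conj_rev t0)) != 0.
  by rewrite t0A t0B map_window_mx det_map_mx fmorph_eq0.
(* Absolute continuity turns the null zero set of the minor into an event of probability 0. *)
have PZ := cPhi _ mZ (polyfun_zeros_null pQ Q0).
exists ((@mx_coords R M N \o Phi) @^-1`
  [set t | \det (window_mx k p q (coords_mx (complex_tuple t))
    (coords_conj_rev (complex_tuple t))) = 0]); split.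
- by rewrite -[X in measurable X]setTI; exact: mPhi.
- exact: PZ.
- move=> w /= nu; apply: contrapT => /eqP.
  rewrite coords_mxK coords_conj_revK => detw.
  by apply: nu; apply: universal_of_inj; exact: toeplitz_compression_inj detw.
Qed.
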